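(* Let $n,k$ be positive integers with $4\le 2k\le n$, and let $G=\{g_1<\dots<g_r\}\subseteq[n]$ be a generator (so $|G|=r$). Then: (i) The family $\mathcal{F}_G=\mathcal{F}(G)\cup\mathcal{F}(\mathcal{H}(G))$ is a maximal left-compressed intersecting family (MLCIF), and $$|\mathcal{F}_G|=\sum_{A\in\mathcal{L}_0(G)}\binom{n-\max A}{k-|G|}+\binom{n-1}{k-1}-\big|\mathcal{L}\big(\pi_{k-1}(n+1-\overline{G})\big)\big|.$$ (ii) If $G$ is a weak generator, then: - if $g_r<2r-2$, then $|\mathcal{F}_G|>|\mathcal{F}_{G\setminus\{g_r\}}|$; - if $g_r=2r-2$, then $|\mathcal{F}_G|=|\mathcal{F}_{G\setminus\{g_r\}}|$; - if $g_r>2r-2$, then $|\mathcal{F}_G|<|\mathcal{F}_{G\setminus\{g_r\}}|$. (iii) If $G$ is a strong generator, then for every generator $K\le G$ we have $|\mathcal{F}_K|\ge|\mathcal{F}_G|$.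
   Context: $[n]=\{1,\dots,n\}$, $[a,b]=\{a,a+1,\dots,b\}$ (empty if $a>b$); elements of a set are always listed in increasing order; $\binom{X}{k}$ denotes the family of $k$-element subsets of $X$. For sets $A=\{a_1<\dots<a_r\}$, $B=\{b_1<\dots<b_r\}$ of the same size, $A\le B$ means $a_i\le b_i$ for all $i$. For $A=\{a_1<\dots<a_r\}$, $B=\{b_1<\dots<b_s\}$, $A\preceq B$ means $r\ge s$ and $a_i\le b_i$ for $1\le i\le s$. $\pi_s(A)$ is the set of the $s$ smallest elements of $A$. If $\max A<m$, then $m-A=\{m-a:a\in A\}$. For $\mathcal{G}\subseteq 2^{[n]}$, $\mathcal{F}(\mathcal{G})=\{A\in\binom{[n]}{k}:A\preceq G\text{ for some }G\in\mathcal{G}\}$, and $\mathcal{F}(G)=\mathcal{F}(\{G\})$. For $A\subseteq[n]$, $\mathcal{L}(A)=\{S\in\binom{[n]}{|A|}:S\le A\}$ and $\mathcal{L}_0(A)=\{S\in\binom{[2,n]}{|A|}:S\le A\}$. A family $\mathcal{A}\subseteq\binom{[n]}{k}$ is intersecting if any two of its members meet; it is left-compressed if $A\in\mathcal{A}$ and $B\le A$ imply $B\in\mathcal{A}$. An intersecting family $\mathcal{A}\subseteq\binom{[n]}{k}$ is maximal if no $k$-set can be added to it without destroying the intersecting property. An MLCIF is a left-compressed intersecting family that is maximal. A nonempty set $G\subseteq[n]$ is self-strongly intersecting if $G'\cap G''\ne\varnothing$ for all $G',G''\subseteq[n]$ with $G'\le G$ and $G''\le G$. For such $G=\{g_1<\dots<g_r\}$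 there is $s\in\{1,\dots,r\}$ with $g_s\le 2s-1$; the smallest such $s$ is the type of $G$, denoted $t(G)$. All generating sets are assumed to have size at most $k$. A generator is a self-strongly intersecting set $G$ (with $|G|\le k$) such that $1\notin G$ and $|G\cap[k+|G|-1]|=|G|$ (that is, $G\subseteq[k+|G|-1]$). A generator $G$ is weak if $t(G)<|G|$ and strong if $t(G)=|G|$. If $G$ is a weak generator, then $G\setminus\{\max G\}$ is again a generator. For a generator $G=\{g_1<\dots<g_r\}$ put $G_i=\{1\}\cup[i+1,g_i]$ for $1\le i\le r$, $\mathcal{H}(G)=\{G_1,\dots,G_r\}$, $\mathcal{F}_G=\mathcal{F}(G)\cup\mathcal{F}(\mathcal{H}(G))=\mathcal{F}(G)\cup\mathcal{F}(G_1)\cup\dots\cup\mathcal{F}(G_r)$, and $\overline{G}=[k+r]\setminus G$ (a $k$-element set).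
   Formalization: In (ii), the two strict inequalities (cases g_r<2r-2 and g_r>2r-2) are stated only for n>2k; for n=2k both families always have size C(n-1,k-1), e.g. n=6, k=3, G={2,3,5}, so strictness fails there. *)

(* Defs.v *)
From mathcomp Require Import all_boot all_order all_algebra.

Set Implicit Arguments.
Unset Strict Implicit.
Unset Printing Implicit Defensive.

(* Subsets of [n] = {1, ..., n} are sets of type {set 'I_n.+1} contained in
   [itv n 1 n], so that an element of 'I_n.+1 is literally the integer it
   stands for; the element 0 is never used. *)

(* [a, b], meant for b <= n *)
Definition itv (n a b : nat) : {set 'I_n.+1} :=
  [set i : 'I_n.+1 | a <= i <= b].

(* binom(X, m) *)
Definition subsets_card (n : nat) (X : {set 'I_n.+1}) (m : nat) :
    {set {set 'I_n.+1}} :=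
  [set A : {set 'I_n.+1} | (A \subset X) && (#|A| == m)].

Definition elems (n : nat) (A : {set 'I_n.+1}) : seq nat :=
  [seq val i | i <- enum A].

(* [enum] lists ordinals in increasing order. *)
Lemma elems_sorted (n : nat) (A : {set 'I_n.+1}) : sorted ltn (elems A).
Proof.
rewrite /elems sorted_map /enum_mem; apply: sorted_filter.
  by move=> x y z; apply: ltn_trans.
have := iota_ltn_sorted 0 n.+1.
by rewrite -val_enum_ord sorted_map enumT.
Qed.

(* The s-th smallest element of A, for 1 <= s <= #|A|: numbering from 1. *)
Definition elt (n : nat) (A : {set 'I_n.+1}) (s : nat) : nat :=
  nth 0 (elems A) s.-1.

(* A <= B *)
Definition cle (n : nat) (A B : {set 'I_n.+1}) : bool :=
  (#|A| == #|B|) && [forall i : 'I_#|A|, elt A i.+1 <= elt B i.+1].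

(* A \preceq B *)
Definition cpre (n : nat) (A B : {set 'I_n.+1}) : bool :=
  (#|B| <= #|A|) && [forall i : 'I_#|B|, elt A i.+1 <= elt B i.+1].

(* pi_s(A) *)
Definition smallest (n s : nat) (A : {set 'I_n.+1}) : {set 'I_n.+1} :=
  [set i in A | val i \in take s (elems A)].

(* m - A, meant for max A < m and m - min A <= n *)
Definition reflect_set (n m : nat) (A : {set 'I_n.+1}) : {set 'I_n.+1} :=
  [set i : 'I_n.+1 | [exists a in A, val i == m - a]].

(* F(GG) for a family GG *)
Definition gen_family (n k : nat) (GG : {set {set 'I_n.+1}}) :
    {set {set 'I_n.+1}} :=
  [set A in subsets_card (itv n 1 n) k | [exists G in GG, cpre A G]].

(* L(A) *)
Definition lower (n : nat) (A : {set 'I_n.+1}) : {set {set 'I_n.+1}} :=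
  [set S in subsets_card (itv n 1 n) #|A| | cle S A].

(* L_0(A) *)
Definition lower0 (n : nat) (A : {set 'I_n.+1}) : {set {set 'I_n.+1}} :=
  [set S in subsets_card (itv n 2 n) #|A| | cle S A].

Definition intersecting (n : nat) (F : {set {set 'I_n.+1}}) : Prop :=
  forall A B : {set 'I_n.+1}, A \in F -> B \in F -> A :&: B != set0.

Definition left_compressed (n : nat) (F : {set {set 'I_n.+1}}) : Prop :=
  forall A B : {set 'I_n.+1}, A \in F -> B \subset itv n 1 n -> cle B A -> B \in F.

Definition maximal_intersecting (n k : nat) (F : {set {set 'I_n.+1}}) : Prop :=
  intersecting F /\
  forall B : {set 'I_n.+1}, B \in subsets_card (itv n 1 n) k -> B \notin F ->
    ~ intersecting (B |: F).

Definition MLCIF (n k : nat) (F : {set {set 'I_n.+1}}) : Prop :=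
  [/\ F \subset subsets_card (itv n 1 n) k,
      left_compressed F
    & maximal_intersecting k F].

Definition self_strongly_intersecting (n : nat) (G : {set 'I_n.+1}) : Prop :=
  [/\ G \subset itv n 1 n,
      G != set0
    & forall G' G'' : {set 'I_n.+1},
        G' \subset itv n 1 n -> G'' \subset itv n 1 n ->
        cle G' G -> cle G'' G -> G' :&: G'' != set0].

(* t(G): the smallest s in {1, ..., #|G|} with g_s <= 2s - 1; such an s exists
   for every self-strongly intersecting G (otherwise this is #|G|.+1). *)
Definition gtype (n : nat) (G : {set 'I_n.+1}) : nat :=
  (find (fun s => elt G s <= 2 * s - 1) (iota 1 #|G|)).+1.

Definition generator (n k : nat) (G : {set 'I_n.+1}) : Prop :=
  [/\ self_strongly_intersecting G,
      #|G| <= k,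
      1 \notin elems G
    & #|G :&: itv n 1 (k + #|G| - 1)| = #|G|].

Definition weak_generator (n k : nat) (G : {set 'I_n.+1}) : Prop :=
  generator k G /\ gtype G < #|G|.

Definition strong_generator (n k : nat) (G : {set 'I_n.+1}) : Prop :=
  generator k G /\ gtype G = #|G|.

(* G_i = {1} u [i+1, g_i] *)
Definition gen_i (n : nat) (G : {set 'I_n.+1}) (i : nat) : {set 'I_n.+1} :=
  itv n 1 1 :|: itv n i.+1 (elt G i).

(* H(G) *)
Definition gen_H (n : nat) (G : {set 'I_n.+1}) : {set {set 'I_n.+1}} :=
  [set gen_i G i.+1 | i : 'I_#|G|].

(* F_G *)
Definition F_gen (n k : nat) (G : {set 'I_n.+1}) : {set {set 'I_n.+1}} :=
  gen_family k [set G] :|: gen_family k (gen_H G).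

(* [k+r] \ G *)
Definition gen_bar (n k : nat) (G : {set 'I_n.+1}) : {set 'I_n.+1} :=
  itv n 1 (k + #|G|) :\: G.

(* max A, for A nonempty *)
Definition set_max (n : nat) (A : {set 'I_n.+1}) : nat :=
  \max_(i in A) val i.

(* G \ {g_r} *)
Definition del_last (n : nat) (G : {set 'I_n.+1}) : {set 'I_n.+1} :=
  [set i in G | val i != elt G #|G|].

(* Main.v *)
Require Import Defs.
From mathcomp Require Import all_boot all_order all_algebra.
From mathcomp Require Import zify.

(** Write A(m) = |A ∩ [m]|. Then A \preceq B means A(m) >= B(m) for all m, and a
    set G is self-strongly intersecting iff 2 G(m) > m for some m. A k-set A
    not containing 1 lies in F_G iff A(m) >= G(m) for all m, while a k-set A
    containing 1 lies in F_G iff A(m) + G(m) > m for some m; these two conditions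
    are exchanged by complementation, whence maximality. Let P_l(G) be the number
    of l-sets B in [2, n] with B \preceq G. Complementing the k-sets through 1
    outside F_G gives |F_G| = C(n-1, k-1) + P_k(G) - P_(n-k)(G).
    If K <= G with G strong, or if K = G and G is replaced by G \ {g_r}, the sets counted by
    P_l(G) but not by P_l(K) are recognised on an initial segment [m], so
    P_l(G) - P_l(K) is a sum of binomials C(n-m, l-t) with coefficients independent
    of l. Parts (ii) and (iii) compare C(n-m, k-t) with C(n-m, n-k-t). *)

(** * Counting functions of sets *)

Lemma in_itv {n : nat} (a b : nat) (i : 'I_n.+1) : (i \in itv n a b) = (a <= i <= b).
Proof. by rewrite inE. Qed.

Lemma card_itv (n a b : nat) : b <= n -> #|itv n a b| = b.+1 - a.
Proof.
move=> bn; rewrite -sum1_card (eq_bigl (fun i : 'I_n.+1 => a <= i <= b)); last first.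
  by move=> i; rewrite in_itv.
rewrite -(big_mkord (fun i => a <= i <= b) (fun=> 1)).
rewrite -[RHS]muln1 -sum_nat_const_nat (big_nat_widenl a 0) //.
by rewrite (big_nat_widen 0 b.+1 n.+1).
Qed.

Definition upto {n : nat} (A : {set 'I_n.+1}) (m : nat) : nat := #|A :&: itv n 1 m|.

Lemma itv_over (n a m : nat) : n <= m -> itv n a m = itv n a n.
Proof.
by move=> nm; apply/setP=> i; rewrite !in_itv; have := ltn_ord i; lia.
Qed.

Lemma card_itv_leq (n m : nat) : #|itv n 1 m| <= m.
Proof.
case: (leqP m n) => [mn|/ltnW nm]; first by rewrite card_itv // subn1.
by rewrite itv_over // card_itv // subn1.
Qed.

Lemma itvS (n a b c : nat) : b <= c -> itv n a b \subset itv n a c.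
Proof.
move=> bc; apply/subsetP=> i; rewrite !in_itv => /andP[-> ib].
exact: leq_trans bc.
Qed.

Lemma upto_leq {n} (A : {set 'I_n.+1}) m : upto A m <= m.
Proof. exact: leq_trans (subset_leq_card (subsetIr _ _)) (card_itv_leq _ _). Qed.

Lemma upto_mono {n} (A : {set 'I_n.+1}) m p : m <= p -> upto A m <= upto A p.
Proof. by move=> mp; apply: subset_leq_card; apply/setIS/itvS. Qed.

Lemma upto_over {n} (A : {set 'I_n.+1}) m : n <= m -> upto A m = upto A n.
Proof. by move=> nm; rewrite /upto itv_over. Qed.

Lemma upto_card {n} (A : {set 'I_n.+1}) m : upto A m <= #|A|.
Proof. exact/subset_leq_card/subsetIl. Qed.

Lemma upto_full {n} (A : {set 'I_n.+1}) m : A \subset itv n 1 m -> upto A m = #|A|.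
Proof. by move=> /setIidPl AI; rewrite /upto AI. Qed.

Lemma upto_sub {n} (A : {set 'I_n.+1}) m : upto A m = #|A| -> A \subset itv n 1 m.
Proof.
move=> e; apply/setIidPl/eqP; rewrite eqEcard subsetIl /=.
by rewrite -e.
Qed.

Lemma upto_lip {n} (A : {set 'I_n.+1}) m p : m <= p -> upto A p <= upto A m + (p - m).
Proof.
move=> mp.
have -> : upto A p = #|A :&: itv n 1 p :&: itv n 1 m| + #|(A :&: itv n 1 p) :\: itv n 1 m|.
  by rewrite cardsID.
apply: leq_add.
  by apply: subset_leq_card; apply/subsetP=> i; rewrite !inE; lia.
(* Endpoints beyond n are cut back to n, because [card_itv] needs its right end in range. *)
case: (leqP p n) => [pn|np].
  apply: (@leq_trans #|itv n m.+1 p|); last by rewrite card_itv // subSS.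
  by apply: subset_leq_card; apply/subsetP=> i; rewrite !inE; lia.
case: (leqP m n) => [mn|nm].
  apply: (@leq_trans #|itv n m.+1 n|); last by rewrite card_itv // subSS; lia.
  by apply: subset_leq_card; apply/subsetP=> i; rewrite !inE; have := ltn_ord i; lia.
apply: (@leq_trans #|(set0 : {set 'I_n.+1})|); last by rewrite cards0.
by apply: subset_leq_card; apply/subsetP=> i; rewrite !inE; have := ltn_ord i; lia.
Qed.

(** Pigeonhole in [m]: disjoint sets together have at most m elements there. *)
Lemma upto_meet {n} (A B : {set 'I_n.+1}) m :
  m < upto A m + upto B m -> A :&: B != set0.
Proof.
move=> h; apply/negP=> /eqP AB0.
have := cardsUI (A :&: itv n 1 m) (B :&: itv n 1 m).
rewrite setIACA AB0 set0I cards0 addn0 -setIUl.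
have := subset_leq_card (subsetIr (A :|: B) (itv n 1 m)).
have := card_itv_leq n m; rewrite /upto in h; lia.
Qed.

Lemma upto_compl {n} (A : {set 'I_n.+1}) m :
  m <= n -> upto A m + upto (itv n 1 n :\: A) m = m.
Proof.
move=> mn; have /esym := card_itv n 1 m mn; rewrite subn1 /= => e.
rewrite [RHS]e -(cardsID A (itv n 1 m)) /upto setIC; congr (_ + _).
by apply: eq_card => i; rewrite !inE; lia.
Qed.

(** In an increasing list the entries at most m form an initial run. *)
Lemma count_take_sorted (s : seq nat) m j :
  sorted ltn s -> count (leq^~ m) (take j s) = minn j (count (leq^~ m) s).
Proof.
elim: s j => [|x s IH] [|j] //= xs; rewrite ?min0n ?minn0 //.
rewrite IH ?(path_sorted xs) //.
have [xm|mx] := leqP x m; first by rewrite !add1n minnSS.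
suff -> : count (leq^~ m) s = 0 by rewrite ?minn0.
apply/eqP; rewrite eqn0Ngt -has_count; apply/hasPn=> y ys.
have /allP/(_ y ys) := order_path_min ltn_trans xs; rewrite /=; lia.
Qed.

Lemma nth_count_sorted (s : seq nat) m i :
  sorted ltn s -> i < size s -> (nth 0 s i <= m) = (i < count (leq^~ m) s).
Proof.
elim: s i => [|x s IH] // i xs; rewrite /= in xs.
have [xm|mx] := leqP x m.
  case: i => [|i] /=; first by rewrite xm.
  by rewrite ltnS xm add1n ltnS => /IH -> //; apply: path_sorted xs.
have A y : y \in s -> m < y.
  by move=> ys; have /allP/(_ y ys) := order_path_min ltn_trans xs; rewrite /=; lia.
have -> : count (leq^~ m) (x :: s) = 0.
  apply/eqP; rewrite eqn0Ngt -has_count; apply/hasPn=> y.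
  by rewrite inE => /orP[/eqP->|/A]; rewrite /=; lia.
case: i => [|i] /=; first by lia.
by rewrite ltnS => /(mem_nth 0)/A h; apply/negbTE; rewrite -ltnNge.
Qed.

Lemma size_elems {n} (A : {set 'I_n.+1}) : size (elems A) = #|A|.
Proof. by rewrite size_map cardE. Qed.

Lemma mem_elems {n} (A : {set 'I_n.+1}) (i : 'I_n.+1) : (val i \in elems A) = (i \in A).
Proof. by rewrite mem_map ?mem_enum //; apply: val_inj. Qed.

Lemma upto_count {n} (A : {set 'I_n.+1}) m : A \subset itv n 1 n ->
  upto A m = count (leq^~ m) (elems A).
Proof.
move=> /subsetP Ag; rewrite count_map /upto cardE -size_filter; congr size.
rewrite /enum_mem -filter_predI; apply: eq_filter => i.
rewrite !inE /=; have [iA|] := boolP (i \in A); rewrite ?andbF //=.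
by move: (Ag i iA); rewrite in_itv andbT => /andP[-> _].
Qed.

(** The dictionary between ranks and counting functions; it turns the orders on sets into pointwise
    inequalities of [upto]. *)
Lemma leq_elt {n} (A : {set 'I_n.+1}) s m : A \subset itv n 1 n -> 0 < s <= #|A| ->
  (elt A s <= m) = (s <= upto A m).
Proof.
case: s => // s Ag /= sA; rewrite /elt upto_count // nth_count_sorted //=.
  exact: elems_sorted.
by rewrite size_elems.
Qed.

(* [dom A B] is A \preceq B, and A <= B when |A| = |B|. *)
Definition dom {n} (A B : {set 'I_n.+1}) : bool :=
  [forall m : 'I_n.+1, upto B m <= upto A m].

(** Testing m up to n suffices, since counting functions are constant from n on. *)
Lemma domP {n} (A B : {set 'I_n.+1}) :
  reflect (forall m, upto B m <= upto A m) (dom A B).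
Proof.
apply: (iffP forallP) => [h m|h m]; last exact: h.
case: (leqP m n) => [mn|/ltnW nm]; first exact: (h (Ordinal (mn : m < n.+1))).
by rewrite !(upto_over _ m nm) (h ord_max).
Qed.

Lemma cpre_dom {n} (A B : {set 'I_n.+1}) : A \subset itv n 1 n -> B \subset itv n 1 n ->
  cpre A B = dom A B.
Proof.
move=> Ag Bg; apply/andP/domP => [[BA /forallP h] m|h].
  have := upto_card B m.
  case e: (upto B m) => [|s] // sB.
  have sA := leq_trans sB BA.
  (* With [s.+1] = B(m), the element of B of this rank is at most m, hence so is that of A. *)
  rewrite -leq_elt //; apply: leq_trans (h (Ordinal sB)) _.
  by rewrite leq_elt // e.
have BA : #|B| <= #|A| by rewrite -(upto_full _ _ Ag) -(upto_full _ _ Bg).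
split=> //; apply/forallP => i; have iB := ltn_ord i; have iA := leq_trans iB BA.
by rewrite leq_elt //; apply: leq_trans (h _); rewrite -leq_elt.
Qed.

Lemma cle_dom {n} (A B : {set 'I_n.+1}) : A \subset itv n 1 n -> B \subset itv n 1 n ->
  cle A B = (#|A| == #|B|) && dom A B.
Proof.
move=> Ag Bg; rewrite -cpre_dom // /cle /cpre.
by case: eqP => //= e; rewrite e leqnn.
Qed.

Lemma elems_smallest {n} s (A : {set 'I_n.+1}) : elems (smallest s A) = take s (elems A).
Proof.
apply: (irr_sorted_eq ltn_trans ltnn); rewrite ?take_sorted ?elems_sorted // => x.
have [xn|nx] := ltnP x n.+1.
  rewrite -[x]/(val (Ordinal xn)) mem_elems inE; apply: andb_idl => /mem_take.
  by rewrite mem_elems.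
apply/idP/idP.
  by case/mapP=> i _ e; have := ltn_ord i; rewrite e in nx; move: nx; rewrite /=; lia.
move/mem_take; case/mapP=> i _ e; have := ltn_ord i; rewrite e in nx; move: nx; rewrite /=; lia.
Qed.

Lemma smallest_sub {n} s (A : {set 'I_n.+1}) : smallest s A \subset A.
Proof. by apply/subsetP=> i; rewrite inE => /andP[]. Qed.

Lemma upto_smallest {n} s (A : {set 'I_n.+1}) m : A \subset itv n 1 n ->
  upto (smallest s A) m = minn s (upto A m).
Proof.
move=> Ag; rewrite !upto_count ?elems_smallest ?count_take_sorted ?elems_sorted //.
exact: subset_trans (smallest_sub _ _) Ag.
Qed.

Lemma card_smallest {n} s (A : {set 'I_n.+1}) : #|smallest s A| = minn s #|A|.
Proof. by rewrite -!size_elems elems_smallest size_take_min. Qed.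

(** * Membership in F_G *)

(** Consecutive binomials have ratio (N - b)/(b + 1), which exceeds 1 below the middle. *)
Lemma bin_lt_half (N a b : nat) : a < b -> 2 * b <= N -> 'C(N, a) < 'C(N, b).
Proof.
elim: b => // b IH ab bN.
have step : 'C(N, b) < 'C(N, b.+1).
  have := mul_bin_left N b; have : 0 < 'C(N, b) by rewrite bin_gt0; lia.
  nia.
move: ab; rewrite ltnS leq_eqVlt => /orP[/eqP-> //|ab].
by apply: ltn_trans step; apply: IH => //; lia.
Qed.

(** The hypotheses place b nearer to N/2 than a; if b lies past the middle, N - b takes its
    place. *)
Lemma bin_lt_inner (N a b : nat) : a < b -> a + b < N -> 'C(N, a) < 'C(N, b).
Proof.
move=> ab abN; have [bN|Nb] := leqP (2 * b) N; first exact: bin_lt_half.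
by rewrite -(bin_sub (n := N) (m := b)); [apply: bin_lt_half|]; lia.
Qed.

Lemma bin_leq_inner (N a b : nat) : a <= b -> a + b <= N -> 'C(N, a) <= 'C(N, b).
Proof.
rewrite leq_eqVlt => /orP[/eqP-> //|ab].
rewrite leq_eqVlt => /orP[/eqP<-|abN]; last exact/ltnW/bin_lt_inner.
by rewrite -(bin_sub (n := a + b) (m := a)) ?leq_addr // addKn.
Qed.

Lemma card_in_cancel {aT rT : finType} (X : {set aT}) (Y : {set rT}) f g :
  (forall x, x \in X -> f x \in Y) -> (forall y, y \in Y -> g y \in X) ->
  {in X, cancel f g} -> {in Y, cancel g f} -> #|X| = #|Y|.
Proof.
move=> fX gY fK gK; apply/eqP; rewrite eqn_leq; apply/andP; split.
  rewrite -(card_in_imset (can_in_inj fK)); apply: subset_leq_card.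
  by apply/subsetP=> _ /imsetP[x xX ->]; apply: fX.
rewrite -(card_in_imset (can_in_inj gK)); apply: subset_leq_card.
by apply/subsetP=> _ /imsetP[x xX ->]; apply: gY.
Qed.

(** Once the trace on [m] is fixed, the rest is an arbitrary subset of [m+1, n] of the remaining
    size. *)
Lemma card_cylinder {n} (T : {set 'I_n.+1}) m l :
    T \subset itv n 1 m -> m <= n -> #|T| <= l ->
  #|[set B in subsets_card (itv n 1 n) l | B :&: itv n 1 m == T]| = 'C(n - m, l - #|T|).
Proof.
move=> /subsetP Tm mn Tl; have <- : #|itv n m.+1 n| = n - m by rewrite card_itv // subSS.
rewrite -cards_draws; apply: (@card_in_cancel _ _ _ _ (fun B => B :\: itv n 1 m) (setU T)).
- move=> B; rewrite !inE => /andP[/andP[/subsetP Bn /eqP Bl] /eqP BT].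
  apply/andP; split; last by rewrite cardsD BT Bl.
  apply/subsetP=> i; rewrite inE => /andP[im /Bn]; move: im; rewrite !inE; lia.
- move=> U; rewrite !inE => /andP[/subsetP Un /eqP Ul].
  have TU : [disjoint T & U].
    apply/pred0P=> i /=; apply/negP=> /andP[iT iU]; have := Tm i iT; have := Un i iU.
    by rewrite !inE; lia.
  apply/andP; split; first apply/andP; first split.
  + apply/subsetP=> i; rewrite !inE => /orP[/Tm|/Un]; rewrite !inE; lia.
  + by rewrite cardsU disjoint_setI0 // cards0 Ul subn0 subnKC.
  + apply/eqP/setP=> i; rewrite !inE; have := Tm i; have := Un i; rewrite !inE.
    by case: (i \in T); case: (i \in U) => /=; lia.
- move=> B; rewrite !inE => /andP[_ /eqP <-]; apply/setP=> i; rewrite !inE.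
  by case: (i \in B); lia.
- move=> U; rewrite !inE => /andP[/subsetP Un _]; apply/setP=> i; rewrite !inE.
  have := Tm i; have := Un i; rewrite !inE.
  by case: (i \in T); case: (i \in U) => /=; lia.
Qed.

Lemma count_odd_iota m : count odd (iota 1 m) = uphalf m.
Proof. by elim: m => // m IH; rewrite -[m.+1]addn1 iotaD count_cat IH /=; lia. Qed.

Lemma upto_nat_pred {n} (p : pred nat) (l : nat) m : m <= n ->
  upto [set i : 'I_n.+1 | p i & 0 < i <= l] m = count p (iota 1 (minn m l)).
Proof.
move=> mn; rewrite /upto -sum1_card -sum1_count.
rewrite (eq_bigl (fun i : 'I_n.+1 => p i && (0 < i <= minn m l))); last first.
  by move=> i; rewrite !inE; lia.
rewrite -(big_mkord (fun i => p i && (0 < i <= minn m l)) (fun=> 1)).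
have -> : iota 1 (minn m l) = index_iota 1 (minn m l).+1 by rewrite /index_iota subn1.
rewrite [RHS](big_nat_widenl 1 0) // [RHS](big_nat_widen 0 _ n.+1); last by lia.
by apply: eq_bigl => i; lia.
Qed.

(** If G never fills more than half of an initial segment, the odd and the even numbers of [2r] give
    two disjoint sets below G. *)
Lemma ssi_upto {n} (G : {set 'I_n.+1}) : self_strongly_intersecting G ->
  exists m, m < 2 * upto G m.
Proof.
case=> Gn _ ssi; suff /existsP[m] : [exists m : 'I_n.+1, m < 2 * upto G m] by exists m.
apply: contraT => /existsPn; set r := #|G| => noM.
have h m : m <= n -> 2 * upto G m <= m.
  by move=> mn; rewrite leqNgt; apply: (noM (Ordinal (mn : m < n.+1))).
have rn : 2 * r <= n by rewrite /r -(upto_full _ _ Gn) h.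
(* [E true] is {1, 3, ..., 2r-1} and [E false] is {2, 4, ..., 2r}; both fit in [n] because 2r <=
   n. *)
pose E (b : bool) := [set i : 'I_n.+1 | odd i == b & 0 < i <= 2 * r].
have En b : E b \subset itv n 1 n.
  by apply/subsetP=> i; rewrite !inE; have := ltn_ord i; lia.
have upE b m : m <= n -> upto (E b) m = if b then uphalf (minn m (2 * r)) else (minn m (2 * r))./2.
  move=> mn; rewrite /E (upto_nat_pred (fun i => odd i == b)) //.
  have := count_predC odd (iota 1 (minn m (2 * r))); have := count_odd_iota (minn m (2 * r)).
  case: b; rewrite size_iota.
    by move=> <- _; apply: eq_count => x; case: (odd x).
  have -> : count (fun i => odd i == false) =1 count (predC odd).
    by apply: eq_count => x /=; case: (odd x).
  by move=> co ce; rewrite -[RHS]/(minn m (2 * r))./2; lia.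
have cE b : cle (E b) G.
  rewrite cle_dom // -(upto_full _ _ (En b)) upE // -/r.
  apply/andP; split; first by case: b; lia.
  apply/forallP=> m; have mn : m <= n by rewrite -ltnS.
  rewrite upE //; have := h _ mn; have := upto_card G m; rewrite -/r.
  by case: b; lia.
have /set0Pn[i] := ssi _ _ (En true) (En false) (cE true) (cE false).
by rewrite !inE; lia.
Qed.

(* Self-strong intersection is used only through its last clause: G contains more
   than half of some initial segment [m]. *)
Definition count_generator {n} (k : nat) (G : {set 'I_n.+1}) : Prop :=
  [/\ G \subset itv n 1 n, upto G 1 = 0, #|G| <= k,
      G \subset itv n 1 (k + #|G| - 1) & exists m, m < 2 * upto G m].

Lemma generator_count {n k} {G : {set 'I_n.+1}} : generator k G -> count_generator k G.
Proof.
case=> ssi rk G1 Gk; split=> //; first by case: ssi.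
- apply/eqP; rewrite cards_eq0; apply/eqP/setP=> i; rewrite !inE; apply/negP.
  move=> /andP[iG i1]; have e : 1 = val i by rewrite /=; lia.
  by rewrite e mem_elems iG in G1.
- by apply/setIidPl/eqP; rewrite eqEcard subsetIl /= Gk.
- exact: ssi_upto.
Qed.

Lemma elt_bounds {n k} {G : {set 'I_n.+1}} s : count_generator k G -> 0 < s <= #|G| ->
  [/\ s < elt G s, elt G s <= n & s <= upto G (elt G s)].
Proof.
move=> [Gn G1 _ _ _] sG; split.
- rewrite ltnNge leq_elt //.
  have : 1 <= s by lia. by move=> /(upto_lip G); lia.
- by rewrite leq_elt // (upto_full _ _ Gn); lia.
- by rewrite -leq_elt.
Qed.

(** The counting function of G_s is 1 on [1, s], then climbs with slope 1 up to g_s, then stays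
    constant. As that of A is monotone with slope at most 1, only m = 1 and m = g_s need testing. *)
Lemma dom_gen_i {n k} {G A : {set 'I_n.+1}} s : count_generator k G -> 0 < s <= #|G| ->
  dom A (gen_i G s) = (0 < upto A 1) && (elt G s < upto A (elt G s) + s).
Proof.
move=> cG sG; have [sg gn _] := elt_bounds s cG sG.
have i1 : #|itv n 1 1| = 1 by rewrite card_itv //; lia.
have Hg : gen_i G s \subset itv n 1 (elt G s).
  by apply/subsetP=> i; rewrite !inE; lia.
have Hs : upto (gen_i G s) s = 1.
  rewrite /upto -i1; apply: eq_card => i; rewrite !inE; lia.
have H1 : upto (gen_i G s) 1 = 1.
  rewrite /upto -[RHS]i1; apply: eq_card => i; rewrite !inE; lia.
have Hc : #|gen_i G s| = (elt G s - s).+1.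
  rewrite /gen_i cardsU i1 card_itv // (_ : _ :&: _ = set0) ?cards0; first by lia.
  apply/setP=> i; rewrite !inE; lia.
apply/domP/andP => [h|[A1 Ag] m].
  have := h 1; have := h (elt G s); rewrite (upto_full _ _ Hg) H1 Hc; lia.
have := upto_leq (gen_i G s) m; have := upto_card (gen_i G s) m.
case: m => [|m]; first by lia.
have A1m : upto A 1 <= upto A m.+1 by apply: upto_mono.
have [ms|sm] := leqP m.+1 s.
  by have := upto_mono (gen_i G s) _ _ ms; rewrite Hs; lia.
have := upto_lip (gen_i G s) _ _ (ltnW sm).
have [mg|gm] := leqP m.+1 (elt G s).
  by have := upto_lip A _ _ mg; lia.
by have := upto_mono A _ _ (ltnW gm); lia.
Qed.

(** Every G_i contains 1, so sets avoiding 1 enter only through G. For sets containing 1, the G_i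
    test A(m) + G(m) > m at m = g_i, and these tests suffice. *)
Lemma mem_F_gen {n k} {G A : {set 'I_n.+1}} : count_generator k G ->
  reflect (A \in subsets_card (itv n 1 n) k /\
           if upto A 1 == 0 then dom A G : Prop else exists m, m < upto A m + upto G m)
          (A \in F_gen k G).
Proof.
move=> cG; have [Gn G1 rk Gk half] := cG.
have gi (s : 'I_#|G|) : gen_i G s.+1 \subset itv n 1 n.
  have [sg gn _] := elt_bounds s.+1 cG (ltn_ord s).
  by apply/subsetP=> i; rewrite !inE; lia.
rewrite /F_gen in_setU !(in_set (fun _ => _ && _)) -andb_orr.
apply: (iffP andP) => [] [Ak h]; split=> //; have An : A \subset itv n 1 n.
- by case/andP: Ak.
- case/orP: h => /exists_inP[H].
    rewrite inE => /eqP->; rewrite cpre_dom // => h; case: eqP => // A1.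
    (* A(m0) >= G(m0) and 2 G(m0) > m0 give the witness. *)
    by case: half => m0 m0G; exists m0; have /domP/(_ m0) := h; lia.
  case/imsetP=> s _ ->; rewrite cpre_dom //.
  have [_ _ sg] := elt_bounds s.+1 cG (ltn_ord s).
  rewrite (dom_gen_i s.+1 cG (ltn_ord s)) => /andP[A1 h]; case: eqP; first by lia.
  by exists (elt G s.+1); lia.
- by case/andP: Ak.
- case: eqP h => [A1|A1 [m h]].
    by move=> h; apply/orP; left; apply/exists_inP; exists G; rewrite ?inE ?cpre_dom.
  have := upto_leq A m; have := upto_card G m.
  (* The rank [s.+1] = G(m) selects the generator: its element is at most m, and moving down from m
     to it preserves the inequality by [upto_lip]. *)
  case e: (upto G m) => [|s] sG Am; first by lia.
  have sG' : 0 < s.+1 <= #|G| by [].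
  have gm : elt G s.+1 <= m by rewrite leq_elt ?e.
  apply/orP; right; apply/exists_inP; exists (gen_i G s.+1).
    by apply/imsetP; exists (Ordinal sG).
  rewrite cpre_dom // ?(gi (Ordinal sG)) // (dom_gen_i s.+1 cG) //.
  by have := upto_lip A _ _ gm; lia.
Qed.

(** * Maximality and the size of F_G *)

(** G has at most k + r - 1 - m elements beyond m. Hence k elements in [m] already ensure the
    condition A(m) + G(m) > m. *)
Lemma count_generator_tail {n k} {G : {set 'I_n.+1}} m : count_generator k G ->
  0 < k -> m <= k + #|G| - 1 -> m < k + upto G m.
Proof.
move=> [_ _ _ Gk _] k0 mk; have := upto_lip G _ _ mk; rewrite (upto_full _ _ Gk); lia.
Qed.

(** Two sets avoiding 1 meet in [m0], where G has more than half; a set avoiding 1 meets one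
    containing 1 in the witness segment [m] of the latter; two sets containing 1 share it. *)
Lemma F_gen_intersecting {n k} {G : {set 'I_n.+1}} : count_generator k G ->
  intersecting (F_gen k G).
Proof.
move=> cG A B /(mem_F_gen cG)[_ hA] /(mem_F_gen cG)[_ hB].
have [_ _ _ _ [m0 hm0]] := cG.
case: eqP hA => A1; case: eqP hB => B1.
- by move=> /domP/(_ m0) hA /domP/(_ m0) hB; apply: (upto_meet _ _ m0); lia.
- by move=> [m hB] /domP/(_ m) hA; apply: (upto_meet _ _ m); lia.
- by move=> /domP hB [m hA]; have := hB m; move=> ?; apply: (upto_meet _ _ m); lia.
- by move=> _ _; apply: (upto_meet _ _ 1); lia.
Qed.

Lemma F_gen_left_compressed {n k} {G : {set 'I_n.+1}} : count_generator k G ->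
  left_compressed (F_gen k G).
Proof.
move=> cG A B /(mem_F_gen cG)[Ak hA] Bn.
have [_ _ _ _ [m0 hm0]] := cG.
have /andP[An /eqP Ac] : (A \subset itv n 1 n) && (#|A| == k) by rewrite inE in Ak.
rewrite cle_dom // => /andP[/eqP BA /domP dBA]; apply/(mem_F_gen cG); split.
  by rewrite inE Bn BA Ac eqxx.
have d1 := dBA 1.
case: eqP => B1; case: eqP hA => A1; try lia.
- by move=> /domP dAG; apply/domP => m; apply: leq_trans (dAG m) (dBA m).
(* Here compression has introduced 1, and the segment [m0] supplies the witness. *)
- by move=> /domP/(_ m0) dAG; exists m0; have := dBA m0; lia.
- by move=> [m hm]; exists m; have := dBA m; lia.
Qed.

(* A set outside F_G misses the k smallest elements of its complement, and these
   form a member of F_G. *)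
Lemma F_gen_maximal {n k} {G : {set 'I_n.+1}} : count_generator k G ->
  0 < k -> 2 * k <= n -> maximal_intersecting k (F_gen k G).
Proof.
move=> cG k0 kn; split=> [|B Bk BF]; first exact: F_gen_intersecting.
have [Gn G1 rk Gk [m0 hm0]] := cG.
have /andP[Bn /eqP Bc] : (B \subset itv n 1 n) && (#|B| == k) by rewrite inE in Bk.
set B' := itv n 1 n :\: B; set A := smallest k B'.
have B'n : B' \subset itv n 1 n by apply: subsetDl.
have B'm m : m <= n -> upto B m + upto B' m = m by apply: upto_compl.
have Am m : upto A m = minn k (upto B' m) by apply: upto_smallest.
have An : A \subset itv n 1 n by apply: subset_trans (smallest_sub _ _) B'n.
have AB : A :&: B = set0.
  apply/setP=> i; rewrite in_setI in_set0; apply/negP=> /andP[+ iB].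
  by move/(subsetP (smallest_sub _ _)); rewrite inE iB.
suff AF : A \in F_gen k G.
  by move/(_ A B (setU1r _ AF) (setU11 _ _)); rewrite AB eqxx.
have B'c := B'm n (leqnn n); rewrite (upto_full _ _ Bn) Bc (upto_full _ _ B'n) in B'c.
have Ac : #|A| = k by rewrite card_smallest; lia.
apply/(mem_F_gen cG); split; first by rewrite inE An Ac eqxx.
have := Am 1; have := B'm 1; have := upto_leq B 1 => B1 B'1 A1.
have [uB|uB] := eqVneq (upto B 1) 0; last first.
  case: eqP; last by lia.
  move=> _; apply/forallP => m; rewrite Am leq_min (leq_trans (upto_card _ _) rk) /=.
  have mn : m <= n by rewrite -ltnS.
  (* B contains 1 here; were the complement to fall short of G at m, then B(m) + G(m) > m and B
     would lie in F_G. *)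
  rewrite leqNgt; apply: contra BF => lt; apply/(mem_F_gen cG); split=> //.
  by rewrite (negbTE uB); exists m; have := B'm _ mn; lia.
case: eqP; first by lia.
move=> _; have /existsP[m lt] : [exists m : 'I_n.+1, upto B m < upto G m].
  apply: contraR BF => /existsPn h; apply/(mem_F_gen cG); split=> //.
  by rewrite uB eqxx; apply/forallP=> m; rewrite leqNgt.
have mn : m <= n by rewrite -ltnS.
(* The deficit B(m) < G(m) makes the full complement satisfy the condition at m. Only truncation to
   k elements could spoil it, and [count_generator_tail] covers that; when m is too large, the end k
   + r - 1 replaces it, as G is exhausted there. *)
have [mk|km] := leqP m (k + #|G| - 1).
  have := count_generator_tail _ cG k0 mk; have := B'm _ mn.
  by exists m; rewrite Am; lia.
have p := count_generator_tail _ cG k0 (leqnn _).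
exists (k + #|G| - 1); rewrite Am.
have := B'm (k + #|G| - 1); have := upto_mono B _ _ (ltnW km).
have := upto_card G m; rewrite (upto_full _ _ Gk); lia.
Qed.

Lemma sub_itv2 {n} (A : {set 'I_n.+1}) :
  (A \subset itv n 2 n) = (A \subset itv n 1 n) && (upto A 1 == 0).
Proof.
rewrite /upto cards_eq0; apply/idP/andP => [/subsetP A2|[/subsetP A1 /eqP/setP A0]].
  split; first by apply/subsetP=> i /A2; rewrite !inE; lia.
  apply/eqP/setP=> i; rewrite !inE; apply/negP=> /andP[/A2]; rewrite inE; lia.
apply/subsetP=> i iA; have := A1 i iA; have := A0 i; rewrite !inE iA /=; lia.
Qed.

(* P_l(G) of the header is the size of this family. *)
Definition avoid {n} (l : nat) (G : {set 'I_n.+1}) : {set {set 'I_n.+1}} :=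
  [set B in subsets_card (itv n 2 n) l | dom B G].

Lemma mem_avoid {n} l (G B : {set 'I_n.+1}) :
  reflect [/\ B \subset itv n 1 n, upto B 1 = 0, #|B| = l & dom B G] (B \in avoid l G).
Proof.
rewrite !inE sub_itv2; apply: (iffP andP) => [[/andP[/andP[? /eqP?] /eqP?] ?]|[-> -> -> ->]] //.
by rewrite !eqxx.
Qed.

(** A set A through 1 is outside F_G iff A(m) + G(m) <= m for all m, that is, iff its complement
    dominates G. The additive form avoids truncated subtraction. *)
Lemma card_F_gen {n k} {G : {set 'I_n.+1}} : count_generator k G -> 0 < k -> k <= n ->
  #|F_gen k G| + #|avoid (n - k) G| = 'C(n - 1, k - 1) + #|avoid k G|.
Proof.
move=> cG k0 kn; have [Gn G1 rk Gk [m0 hm0]] := cG.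
have c1 : #|itv n 1 1| = 1 by rewrite card_itv //; lia.
(* The k-sets through 1, written as a cylinder so that [card_cylinder] counts them. *)
set Y := [set A in subsets_card (itv n 1 n) k | A :&: itv n 1 1 == itv n 1 1].
have memY A : (A \in Y) = (A \in subsets_card (itv n 1 n) k) && (upto A 1 != 0).
  by rewrite inE; congr andb; rewrite eqEcard subsetIr /= c1 lt0n.
have <- : #|Y| = 'C(n - 1, k - 1).
  by rewrite /Y card_cylinder ?c1 //; lia.
have Fs A : A \in F_gen k G -> A \in subsets_card (itv n 1 n) k by case/(mem_F_gen cG).
rewrite -(cardsID Y (F_gen k G)) -(cardsID (F_gen k G) Y) setIC -!addnA; congr (_ + _).
rewrite addnC; congr (_ + _).
  apply/esym; apply: (@card_in_cancel _ _ _ _ (setD (itv n 1 n)) (setD (itv n 1 n))).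
  - move=> A; rewrite in_setD memY => /andP[AF /andP[Ak A1]]; apply/mem_avoid.
    have /andP[An /eqP Ac] : (A \subset itv n 1 n) && (#|A| == k) by rewrite inE in Ak.
    have Bn : itv n 1 n :\: A \subset itv n 1 n by apply: subsetDl.
    have up m := upto_compl A m; split=> //.
    + have := up 1; lia.
    + by have := up n (leqnn n); rewrite (upto_full _ _ An) (upto_full _ _ Bn) Ac; lia.
    + apply/forallP=> m; have mn : m <= n by rewrite -ltnS.
      rewrite leqNgt; apply: contra AF => lt; apply/(mem_F_gen cG); split=> //.
      by rewrite (negbTE A1); exists m; have := up _ mn; lia.
  - move=> B /mem_avoid[Bn B1 Bc /domP dB]; have up m := upto_compl B m.
    have An : itv n 1 n :\: B \subset itv n 1 n by apply: subsetDl.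
    have Ac : #|itv n 1 n :\: B| = k.
      by have := up n (leqnn n); rewrite (upto_full _ _ An) (upto_full _ _ Bn) Bc; lia.
    have A1 : upto (itv n 1 n :\: B) 1 != 0 by have := up 1; lia.
    have As : itv n 1 n :\: B \in subsets_card (itv n 1 n) k by rewrite inE An Ac eqxx.
    rewrite in_setD memY As A1 !andbT.
    apply/negP=> /(mem_F_gen cG)[_]; rewrite (negbTE A1) => -[m].
    have [mn|nm] := leqP m n; first by have := up m mn; have := dB m; lia.
    have := up n (leqnn n); have := dB n.
    rewrite !(upto_over _ _ (ltnW nm)); lia.
  - move=> A; rewrite in_setD memY [A \in subsets_card _ _]inE.
    move=> /andP[_ /andP[/andP[/subsetP An _] _]].
    by apply/setP=> i; have := An i; rewrite !inE; case: (i \in A) => //=; lia.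
  - move=> B /mem_avoid[/subsetP Bn _ _ _].
    by apply/setP=> i; have := Bn i; rewrite !inE; case: (i \in B) => //=; lia.
apply: eq_card => A; rewrite in_setD memY.
apply/andP/mem_avoid => [[AY /[dup] AF /(mem_F_gen cG)[As]]|[An A1 Ac dA]].
  have /andP[An /eqP Ac] : (A \subset itv n 1 n) && (#|A| == k) by rewrite inE in As.
  by move: AY; rewrite As /= negbK => /eqP->; rewrite eqxx.
rewrite A1 eqxx andbF; split=> //; apply/(mem_F_gen cG).
by rewrite inE An Ac A1 !eqxx.
Qed.

(** * The explicit size formula *)

Lemma upto_mem {n} (A : {set 'I_n.+1}) (i : 'I_n.+1) : 0 < i ->
  upto A i = (i \in A) + upto A i.-1.
Proof.
move=> i0; rewrite /upto (cardsD1 i); congr (_ + _); first by rewrite !inE i0 leqnn !andbT.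
apply: eq_card => j; rewrite !inE -val_eqE /=; case: (j \in A) => /=; lia.
Qed.

Lemma upto_inj {n} (A B : {set 'I_n.+1}) : A \subset itv n 1 n -> B \subset itv n 1 n ->
  (forall m, upto A m = upto B m) -> A = B.
Proof.
move=> /subsetP An /subsetP Bn h; apply/setP=> i.
have [i0|i0] := posnP i; last by have := h i; rewrite !upto_mem // h => /addIn; lia.
have := An i; have := Bn i; rewrite !inE i0 /=.
by case: (i \in A); case: (i \in B) => // a b; [have := b isT|have := a isT].
Qed.

Lemma set_maxP {n} (A : {set 'I_n.+1}) : A \subset itv n 1 n -> 0 < #|A| ->
  [/\ 0 < set_max A, set_max A <= n, A \subset itv n 1 (set_max A)
    & upto A (set_max A).-1 < #|A|].
Proof.
move=> /subsetP An A0.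
have [i iA ei] : {i | i \in A & set_max A = val i} by apply: eq_bigmax_cond.
have := An i iA; rewrite inE => /andP[i0 iN].
have Ai : A \subset itv n 1 (set_max A).
  apply/subsetP=> j jA; have := An j jA; rewrite !inE => /andP[-> _] /=.
  exact: (leq_bigmax_cond (F := fun i : 'I_n.+1 => val i)).
split=> //; rewrite ?ei //.
by have := upto_full _ _ Ai; rewrite ei (upto_mem A i) // iA => <-; rewrite add1n.
Qed.

(** Recasts a condition on smallest elements as one on the trace in a fixed initial segment, the
    form counted by [card_cylinder]. *)
Lemma smallest_eq {n} (A B : {set 'I_n.+1}) :
    A \subset itv n 1 n -> B \subset itv n 1 n -> 0 < #|A| ->
  (smallest #|A| B == A) = (B :&: itv n 1 (set_max A) == A).
Proof.
move=> An Bn A0; have [M0 MN AM At] := set_maxP A An A0; set M := set_max A in M0 MN AM At *.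
have sm := upto_smallest #|A| B _ Bn; have AM' := upto_full _ _ AM.
apply/eqP/eqP => e.
  apply/esym/eqP; rewrite eqEcard subsetI AM andbT.
  rewrite -{1}e smallest_sub -[#|_ :&: _|]/(upto B M) /=.
  move: At; rewrite -{1}e sm gtn_min ltnn /=.
  have := upto_lip B _ _ (leq_pred M); have -> : M - M.-1 = 1 by lia.
  by rewrite addn1; apply: leq_trans.
apply: upto_inj => // [|m]; first by apply: subset_trans (smallest_sub _ _) Bn.
have BM : upto B M = #|A| by rewrite /upto e.
rewrite sm; have [mM|/ltnW Mm] := leqP m M.
  have -> : upto A m = upto B m.
    by rewrite -e /upto; apply: eq_card => i; rewrite !inE; lia.
  by have := upto_mono B _ _ mM; lia.
have := upto_mono B _ _ Mm; have := upto_mono A _ _ Mm; have := upto_card A m; lia.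
Qed.

(* A set B \preceq G is determined by its |G| smallest elements together with an
   arbitrary choice of elements beyond them. *)
Lemma card_avoid_sum {n} (l : nat) (G : {set 'I_n.+1}) :
    G \subset itv n 1 n -> 0 < #|G| <= l ->
  #|avoid l G| = \sum_(A in lower0 G) 'C(n - set_max A, l - #|G|).
Proof.
move=> Gn /andP[G0 Gl].
have low (A : {set _}) : reflect [/\ A \subset itv n 1 n, upto A 1 = 0, #|A| = #|G| & dom A G]
                     (A \in lower0 G).
  rewrite inE inE sub_itv2.
  apply: (iffP andP) => [[/andP[/andP[An /eqP A1] /eqP Ac]]|[An A1 Ac dA]].
    by rewrite cle_dom // => /andP[_ dA]; split.
  by rewrite cle_dom // An A1 Ac !eqxx.
rewrite -sum1_card (partition_big (smallest #|G|) (mem (lower0 G))) /=; last first.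
  move=> B /mem_avoid[Bn B1 Bc /domP dB]; apply/low; split.
  - exact: subset_trans (smallest_sub _ _) Bn.
  - by rewrite upto_smallest // B1 minn0.
  - by rewrite card_smallest Bc; apply/minn_idPl.
  - by apply/domP=> m; rewrite upto_smallest // leq_min upto_card dB.
apply: eq_bigr => A /low[An A1 Ac /domP dA].
have A0 : 0 < #|A| by rewrite Ac.
have [M0 MN AM At] := set_maxP A An A0.
(* The fibre over A is the cylinder of sets with trace A on [max A]; domination of G is inherited
   from A. *)
rewrite sum1dep_card -Ac -card_cylinder ?Ac //; apply: eq_card => B.
rewrite inE [RHS]inE [B \in subsets_card _ _]inE -Ac.
apply/andP/andP => [[/mem_avoid[Bn B1 -> dB]]|[/andP[Bn /eqP Bc]]].
  by rewrite smallest_eq // Bn eqxx => ->.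
rewrite smallest_eq // => /[dup] e ->; split=> //; apply/mem_avoid; split=> //.
  apply: etrans A1; rewrite -{1}(eqP e) /upto;
    apply: eq_card => i; rewrite !inE; move: M0; case: (i \in B) => //=; lia.
apply/domP=> m; apply: leq_trans (dA m) _; rewrite -{1}(eqP e).
exact/subset_leq_card/setSI/subsetIl.
Qed.

(** At i = 0 the value n + 1 is out of range and [inord] returns a default, hence the hypotheses
    [0 < i] below. *)
Definition reflect_ord {n} (i : 'I_n.+1) : 'I_n.+1 := inord (n.+1 - i).

Lemma reflect_ordE {n} (i : 'I_n.+1) : 0 < i -> reflect_ord i = n.+1 - i :> nat.
Proof. by move=> i0; rewrite inordK //; lia. Qed.

Lemma mem_reflect {n} (A : {set 'I_n.+1}) (i : 'I_n.+1) : A \subset itv n 1 n ->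
  (i \in reflect_set (n + 1) A) = (0 < i) && (reflect_ord i \in A).
Proof.
move=> /subsetP An; rewrite inE addn1; apply/exists_inP/andP => [[a aA /eqP e]|[i0 iA]].
  have := An a aA; rewrite inE => /andP[a0 an].
  have i0 : 0 < i by rewrite /= in e; lia.
  split=> //; suff -> : reflect_ord i = a by [].
  by apply: val_inj => /=; rewrite reflect_ordE // [nat_of_ord i]e; lia.
exists (reflect_ord i) => //; apply/eqP => /=; rewrite reflect_ordE //.
by have := ltn_ord i; lia.
Qed.

Lemma reflect_ordK {n} (i : 'I_n.+1) : 0 < i -> reflect_ord (reflect_ord i) = i.
Proof.
move=> i0; apply: val_inj => /=; have := ltn_ord i => ni.
by rewrite reflect_ordE reflect_ordE //; lia.
Qed.

Lemma reflect_sub {n} (A : {set 'I_n.+1}) : A \subset itv n 1 n ->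
  reflect_set (n + 1) A \subset itv n 1 n.
Proof.
move=> An; apply/subsetP=> i; rewrite mem_reflect // inE => /andP[-> _].
by rewrite -ltnS ltn_ord.
Qed.

Lemma reflectK {n} (A : {set 'I_n.+1}) : A \subset itv n 1 n ->
  reflect_set (n + 1) (reflect_set (n + 1) A) = A.
Proof.
move=> An; apply/setP=> i; rewrite mem_reflect ?reflect_sub // mem_reflect //.
have [i0|i0] := posnP i.
  by apply/esym/negP=> /(subsetP An); rewrite inE i0.
rewrite reflect_ordK // reflect_ordE //; have := ltn_ord i.
by case: (i \in A); lia.
Qed.

(** Reflection exchanges [m] with the last m elements of [n]. *)
Lemma upto_reflect {n} (A : {set 'I_n.+1}) m : A \subset itv n 1 n -> m <= n ->
  upto (reflect_set (n + 1) A) m + upto A (n - m) = #|A|.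
Proof.
move=> An mn; rewrite addnC -[RHS](cardsID (itv n 1 (n - m))); congr (_ + _).
apply: (@card_in_cancel _ _ _ _ reflect_ord reflect_ord) => i.
- rewrite in_setI mem_reflect // in_setD !inE => /andP[/andP[i0 ->] im].
  by rewrite reflect_ordE //; lia.
- case/setDP=> iA; rewrite inE => im.
  have := subsetP An i iA; rewrite inE => iN.
  rewrite in_setI mem_reflect // inE reflect_ordK ?iA ?reflect_ordE; lia.
- by case/setIP=> _; rewrite inE => /andP[i0 _]; apply: reflect_ordK.
- rewrite in_setD => /andP[_ /(subsetP An)]; rewrite inE => /andP[i0 _].
  exact: reflect_ordK.
Qed.

Lemma card_reflect {n} (A : {set 'I_n.+1}) : A \subset itv n 1 n ->
  #|reflect_set (n + 1) A| = #|A|.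
Proof.
move=> An; have := upto_reflect A n An (leqnn n).
by rewrite (upto_full _ _ (reflect_sub _ An)) subnn; have := upto_leq A 0; lia.
Qed.

(* S |-> [2, n] \ (n + 1 - S) turns the condition S <= pi_(k-1)(n + 1 - gen_bar)
   into membership in [avoid (n - k) G]. *)
Lemma card_lower_reflect {n k} {G : {set 'I_n.+1}} : count_generator k G ->
  0 < k -> 2 * k <= n ->
  #|lower (smallest (k - 1) (reflect_set (n + 1) (gen_bar k G)))| = #|avoid (n - k) G|.
Proof.
move=> [Gn G1 rk Gk _] k0 kn; set H := gen_bar k G.
have Hn : H \subset itv n 1 n by apply/subsetP=> i; rewrite !inE; lia.
have upH m : m <= k + #|G| -> upto H m + upto G m = m.
  move=> mk; rewrite addnC -[RHS](upto_compl G m); last by lia.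
  by congr (_ + _); apply: eq_card => i; rewrite !inE; case: (i \in G); lia.
have GkS : G \subset itv n 1 (k + #|G|).
  by apply: subset_trans Gk _; apply: itvS; lia.
have Hc : #|H| = k.
  have := upH _ (leqnn _); rewrite (upto_full _ _ GkS).
  rewrite upto_full; first by lia.
  exact: subsetDl.
have upH' m : k + #|G| <= m -> upto H m = k.
  move=> km; rewrite -Hc; apply: upto_full; apply: subset_trans (subsetDl _ _) _.
  exact: itvS.
have upG' m : k + #|G| <= m -> upto G m = #|G|.
  by move=> km; apply: upto_full; apply: subset_trans GkS _; apply: itvS.
set R := reflect_set (n + 1) H; have Rn : R \subset itv n 1 n by apply: reflect_sub.
set C := smallest (k - 1) R.
have Cn : C \subset itv n 1 n by apply: subset_trans (smallest_sub _ _) Rn.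
have Cc : #|C| = k - 1 by rewrite card_smallest card_reflect // Hc; lia.
(* Since 1 lies in H, the cap k - 1 takes effect only at m = n: it drops the reflected element n. *)
have upC m : m <= n -> upto C m = minn (k - 1) (k - upto H (n - m)).
  by move=> mn; have := upto_reflect H m Hn mn; rewrite upto_smallest // Hc -/R; lia.
have memL S : S \in lower C = [&& S \subset itv n 1 n, #|S| == k - 1 & dom S C].
  rewrite inE inE Cc; case Sn : (S \subset _) => //=; case: eqP => //= Sc.
  by rewrite cle_dom // Sc Cc eqxx.
pose f (S : {set 'I_n.+1}) := itv n 2 n :\: reflect_set (n + 1) S.
pose g (B : {set 'I_n.+1}) := reflect_set (n + 1) (itv n 2 n :\: B).
have up2 (A : {set 'I_n.+1}) m : upto A 1 = 0 -> 0 < m <= n ->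
    upto A m + upto (itv n 2 n :\: A) m = m - 1.
  move=> A1 /andP[m0 mn].
  have <- : #|itv n 2 m| = m - 1 by rewrite card_itv //; lia.
  rewrite -[RHS](cardsID A); congr (_ + _); apply: eq_card => i; last by rewrite !inE; lia.
  have Ai : i \in A -> val i != 1.
    move=> iA; apply/negP=> /eqP i1.
    by have := upto_mem A i; rewrite -[nat_of_ord i]/(val i) i1 iA A1; lia.
  by move: Ai; rewrite !inE /=; case: (i \in A) => [/(_ isT)|_] /=; lia.
have sub2 (A : {set 'I_n.+1}) : A \subset itv n 2 n -> itv n 2 n :\: (itv n 2 n :\: A) = A.
  by move=> A2; rewrite setDDr setDv set0U; apply/setIidPr.
have c2 (A : {set 'I_n.+1}) : A \subset itv n 2 n -> #|itv n 2 n :\: A| = n - 1 - #|A|.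
  by move=> A2; rewrite cardsD (setIidPr A2) card_itv //; lia.
have s12 (A : {set 'I_n.+1}) : itv n 2 n :\: A \subset itv n 2 n by apply: subsetDl.
have s21 (A : {set 'I_n.+1}) : A \subset itv n 2 n -> A \subset itv n 1 n /\ upto A 1 = 0.
  by rewrite sub_itv2 => /andP[-> /eqP].
have H1 : upto H 1 = 1 by have := upH 1; lia.
have reflL S : S \in lower C ->
    [/\ reflect_set (n + 1) S \subset itv n 2 n, #|reflect_set (n + 1) S| = k - 1
      & forall m, 0 < m <= n -> (upto (reflect_set (n + 1) S) m).+1 <= upto H m].
  rewrite memL => /and3P[Sn /eqP Sc /domP dS].
  (* Domination of C by S at n - m, read through the reflection; the extra 1 is the element 1 of H,
     absent from the reflected S. *)
  have bd m : 0 < m <= n -> (upto (reflect_set (n + 1) S) m).+1 <= upto H m.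
    move=> /andP[m0 mn]; have := dS (n - m); rewrite upC ?leq_subr // subKn //.
    have := upto_reflect S (n - m) Sn (leq_subr _ _); rewrite Sc.
    have := upto_reflect (reflect_set (n + 1) S) (n - m) (reflect_sub _ Sn) (leq_subr _ _).
    rewrite reflectK // subKn // card_reflect // Sc.
    have := upto_mono H _ _ m0; lia.
  split=> //; last by rewrite card_reflect.
  by rewrite sub_itv2 reflect_sub //; have := bd 1; rewrite H1; lia.
have avoidS B : B \in avoid (n - k) G -> B \subset itv n 2 n.
  by case/mem_avoid=> Bn B1 _ _; rewrite sub_itv2 Bn B1.
apply: (@card_in_cancel _ _ _ _ f g).
- move=> S /reflL[A2 Ac bd]; have [An A1] := s21 _ A2.
  have [Bn B1] := s21 _ (s12 (reflect_set (n + 1) S)).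
  (* For m > 0, f(S) has m - 1 minus the reflected count of S in [m], hence at least m - H(m) = G(m)
     elements there. *)
  have le m : m <= k + #|G| -> upto G m <= upto (f S) m.
    case: m => [|m] mk; first by have := upto_leq G 0; lia.
    have mn : 0 < m.+1 <= n by lia.
    by have := bd _ mn; have := up2 _ _ A1 mn; have := upH _ mk; rewrite /f; lia.
  apply/mem_avoid; split=> //; first by rewrite /f c2 // Ac; lia.
  apply/domP=> m; have [mk|/ltnW km] := leqP m (k + #|G|); first exact: le.
  by rewrite upG' // -(upG' _ (leqnn _)); apply: leq_trans (le _ _) (upto_mono _ _ _ km).
- move=> B /[dup] /avoidS B2 /mem_avoid[Bn B1 Bc /domP dB].
  have [Dn D1] := s21 _ (s12 B); have Dc := c2 _ B2.
  rewrite memL /g reflect_sub // card_reflect // Dc Bc; apply/and3P; split=> //.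
    by apply/eqP; lia.
  apply/forallP=> m; have mn : m <= n by rewrite -ltnS.
  have := upto_reflect _ m Dn mn; rewrite Dc Bc upC //.
  case j0 : (n - m) => [|j]; first by have := upto_leq (itv n 2 n :\: B) 0; lia.
  have jn : 0 < j.+1 <= n by lia.
  have := up2 _ _ B1 jn; have := dB j.+1.
  have [jk|/ltnW kj] := leqP j.+1 (k + #|G|); last by rewrite (upH' _ kj); lia.
  by have := upH _ jk; lia.
- move=> S /[dup] SL /reflL[A2 _ _]; rewrite /g /f sub2 // reflectK //.
  by move: SL; rewrite memL => /and3P[].
- by move=> B /avoidS B2; rewrite /f /g reflectK ?sub2 //; case: (s21 _ (s12 B)).
Qed.

(** * Comparing generators *)

(** Sorting by the trace T on [m] leaves l only in the binomials and in the bound [#|T| <= l], so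
    sums for different l can be compared term by term. *)
Lemma card_by_prefix {n} m l (phi : pred {set 'I_n.+1}) : m <= n ->
  #|[set B in subsets_card (itv n 1 n) l | phi (B :&: itv n 1 m)]| =
  \sum_(T : {set 'I_n.+1} | [&& T \subset itv n 1 m, phi T & #|T| <= l]) 'C(n - m, l - #|T|).
Proof.
move=> mn; rewrite -sum1_card.
rewrite (partition_big (fun B => B :&: itv n 1 m)
  (fun T : {set 'I_n.+1} => [&& T \subset itv n 1 m, phi T & #|T| <= l])) /=; last first.
  move=> B; rewrite inE => /andP[+ ->]; rewrite inE => /andP[_ /eqP <-].
  by rewrite subsetIr subset_leq_card ?subsetIl.
apply: eq_bigr => T /and3P[Tm phiT Tl].
rewrite sum1dep_card -(card_cylinder T) //; apply: eq_card => B; rewrite inE [in RHS]inE.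
rewrite [_ \in [set _ | _]]inE -andbA; case: eqP => [->|]; last by rewrite !andbF.
by rewrite phiT.
Qed.

Lemma upto_prefix {n} (B : {set 'I_n.+1}) m p :
  upto (B :&: itv n 1 m) p = upto B (minn p m).
Proof. by apply: eq_card => i; rewrite !inE; case: (i \in B) => //=; lia. Qed.

Lemma dom_prefix {n} (B K : {set 'I_n.+1}) m : K \subset itv n 1 m ->
  dom (B :&: itv n 1 m) K = dom B K.
Proof.
move=> Km; apply/domP/domP => h p.
  by apply: leq_trans (h p) _; rewrite upto_prefix upto_mono // geq_minl.
rewrite upto_prefix; have := h p; case: (leqP p m) => [//|/ltnW mp _]; apply: leq_trans (h m).
by rewrite (upto_full _ _ Km) upto_card.
Qed.

Lemma dom_trans {n} (A B C : {set 'I_n.+1}) : dom A B -> dom B C -> dom A C.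
Proof. by move=> /domP h /domP h'; apply/domP => m; apply: leq_trans (h' m) (h m). Qed.

Lemma card_avoid_dom {n} l (G K : {set 'I_n.+1}) : dom K G ->
  #|avoid l G| = #|avoid l K| + #|[set B in avoid l G | ~~ dom B K]|.
Proof.
move=> KG; rewrite -(cardsID (avoid l K)); congr (_ + _).
  apply: eq_card => B; rewrite in_setI; apply: andb_idl => /mem_avoid[Bn B1 Bc BK].
  by apply/mem_avoid; split=> //; apply: dom_trans KG.
apply: eq_card => B; rewrite in_setD andbC [in RHS]inE; apply: andb_id2l.
case/mem_avoid=> Bn B1 Bc BG; congr negb; apply/mem_avoid/idP => [[]//|BK]; by split.
Qed.

Lemma gtype_half {n} (G : {set 'I_n.+1}) :
  gtype G <= #|G| -> elt G (gtype G) <= 2 * gtype G - 1.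
Proof.
move=> tG; have h : has (fun s => elt G s <= 2 * s - 1) (iota 1 #|G|).
  by rewrite has_find size_iota.
by have := nth_find 0 h; rewrite nth_iota.
Qed.

Lemma upto_del_last {n} (G : {set 'I_n.+1}) m : G \subset itv n 1 n -> 0 < #|G| ->
  upto G m = (elt G #|G| <= m) + upto (del_last G) m.
Proof.
move=> Gn G0; have : elt G #|G| \in elems G by apply: mem_nth; rewrite size_elems; lia.
case/mapP=> i; rewrite mem_enum => iG e.
have := subsetP Gn i iG; rewrite inE => /andP[i0 _].
rewrite /upto (cardsD1 i); congr (_ + _); first by rewrite !inE iG i0 e.
by apply: eq_card => j; rewrite !inE e -val_eqE; case: (j \in G) => /=; lia.
Qed.

Lemma card_del_last {n} (G : {set 'I_n.+1}) : G \subset itv n 1 n -> 0 < #|G| ->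
  #|del_last G| = #|G|.-1.
Proof.
move=> Gn G0; have := upto_del_last G n Gn G0.
have Ln : del_last G \subset itv n 1 n.
  by apply: subset_trans Gn; apply/subsetP=> i; rewrite inE => /andP[].
rewrite leq_elt ?G0 ?leqnn // (upto_full _ _ Gn) leqnn (upto_full _ _ Ln); lia.
Qed.

Lemma count_generator_card {n k} {G : {set 'I_n.+1}} : count_generator k G -> 0 < #|G|.
Proof. by move=> [_ _ _ _ [m h]]; have := upto_card G m; lia. Qed.

Lemma sub_elt_last {n} {G : {set 'I_n.+1}} : G \subset itv n 1 n -> 0 < #|G| ->
  G \subset itv n 1 (elt G #|G|).
Proof.
move=> Gn G0; apply: upto_sub; apply/eqP; rewrite eqn_leq upto_card.
by rewrite -leq_elt ?G0 /=.
Qed.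

(** With t the type, [2t-1] contains at least t elements of G; as t < r, at least t remain there
    after g_r is removed. *)
Lemma del_last_generator {n k} {G : {set 'I_n.+1}} : count_generator k G ->
  gtype G < #|G| -> count_generator k (del_last G).
Proof.
move=> cG tG; have G0 := count_generator_card cG; have [Gn G1 rk Gk _] := cG.
have up m := upto_del_last G m Gn G0; have c := card_del_last G Gn G0.
have Gg := sub_elt_last Gn G0; have gk : elt G #|G| <= k + #|G| - 1.
  by rewrite leq_elt ?G0 ?leqnn // (upto_full _ _ Gk).
have LG : del_last G \subset G by apply/subsetP=> i; rewrite inE => /andP[].
split.
- exact: subset_trans LG Gn.
- by have := up 1; lia.
- by rewrite c; lia.
(* The elements below g_r <= k + r - 1 are at most k + r - 2, the bound required for size r - 1. *)
- apply: upto_sub; rewrite c; have ug := up (elt G #|G|).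
  rewrite (upto_full _ _ Gg) leqnn in ug.
  have := upto_card (del_last G) (k + #|G|.-1 - 1); rewrite c.
  have p : k + #|G|.-1 - 1 <= k + #|G| - 1 by lia.
  have [gp|pg] := leqP (elt G #|G|) (k + #|G|.-1 - 1).
    by have := upto_mono (del_last G) _ _ gp; lia.
  have := upto_lip G _ _ p; rewrite (upto_full _ _ Gk).
  by have := up (k + #|G|.-1 - 1); rewrite leqNgt pg; lia.
- exists (2 * gtype G - 1); have ug := up (elt G #|G|).
  rewrite (upto_full _ _ Gg) leqnn in ug; have t0 : 0 < gtype G by [].
  have := gtype_half G (ltnW tG); rewrite leq_elt // ?(ltnW tG) //.
  have [gp|pg] := leqP (elt G #|G|) (2 * gtype G - 1).
    by have := upto_mono (del_last G) _ _ gp; lia.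
  by have := up (2 * gtype G - 1); rewrite leqNgt pg; lia.
Qed.

(* Sets B in [2, n] with B \preceq G \ {g_r} but not B \preceq G are those having
   exactly r - 1 elements up to g_r, arbitrarily completed beyond. *)
Lemma card_avoid_del_last {n k} {G : {set 'I_n.+1}} : count_generator k G ->
    count_generator k (del_last G) ->
  exists2 Q, 0 < Q & forall l, #|G|.-1 <= l ->
    #|avoid l (del_last G)| = #|avoid l G| + Q * 'C(n - elt G #|G|, l - #|G|.-1).
Proof.
move=> cG cL; have G0 := count_generator_card cG; have [Gn G1 rk Gk _] := cG.
have [Ln L1 _ _ _] := cL.
have up m := upto_del_last G m Gn G0; have c := card_del_last G Gn G0.
have Gg := sub_elt_last Gn G0; set g := elt G #|G| in up Gg *.
have LG : del_last G \subset G by apply/subsetP=> i; rewrite inE => /andP[].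
have Lg := subset_trans LG Gg.
have [rg gn _] : [/\ #|G| < g, g <= n & #|G| <= upto G g].
  by apply: (elt_bounds _ cG); rewrite G0 leqnn.
pose phi (T : {set 'I_n.+1}) := [&& upto T 1 == 0, dom T (del_last G) & #|T| == #|G|.-1].
(* Q counts the possible traces on [g_r]; it is positive because G without g_r is itself one of
   them. *)
exists #|[set T : {set 'I_n.+1} | T \subset itv n 1 g & phi T]|.
  by apply/card_gt0P; exists (del_last G); rewrite inE Lg /phi L1 c !eqxx andbT; apply/domP.
move=> l rl; rewrite (card_avoid_dom _ _ G); last first.
  by apply/domP=> m; rewrite up leq_addl.
congr (_ + _).
have -> : [set B in avoid l (del_last G) | ~~ dom B G]
        = [set B in subsets_card (itv n 1 n) l | phi (B :&: itv n 1 g)].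
  apply/setP=> B; rewrite inE [in RHS]inE [B \in subsets_card _ _]inE /phi.
  rewrite upto_prefix dom_prefix // -[#|_ :&: _|]/(upto B g).
  have -> : minn 1 g = 1 by lia.
  have GgE := upto_full _ _ Gg; have LgE := upto_full _ _ Lg.
  apply/andP/andP => [[/mem_avoid[-> -> -> dB] nd]|].
    rewrite dB !eqxx; split=> //=; rewrite eqn_leq -{2}c -LgE (domP _ _ dB) andbT.
    (* Below g_r the two generators have equal counts, so r elements of B up to g_r would make B
       dominate G. *)
    rewrite -ltnS prednK // ltnNge; apply: contra nd => h.
    apply/domP=> m; have [gm|mg] := leqP g m.
      by apply: leq_trans (upto_card _ _) (leq_trans h (upto_mono _ _ _ gm)).
    by have := up m; rewrite (leqNgt g) mg => ->; apply: (domP _ _ dB).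
  move=> [/andP[Bn /eqP Bc] /and3P[/eqP B1 dB /eqP Bg]].
  split; first by apply/mem_avoid.
  by apply/negP=> /domP/(_ g); rewrite GgE Bg; lia.
rewrite card_by_prefix // -sum_nat_const.
apply: eq_big => T; last by case/and3P=> _ /and3P[_ _ /eqP->].
by rewrite inE; congr andb; apply: andb_idr => /and3P[_ _ /eqP->].
Qed.

(** Membership in the difference is decided by the trace T on [2r-1], and T has t >= r elements.
    Then (k - t) + (n - k - t) = n - 2t is below n - (2r - 1), so [bin_leq_inner] compares the
    terms. *)
Lemma leq_card_avoid_diff {n k} {G K : {set 'I_n.+1}} : count_generator k G ->
    count_generator k K -> #|K| = #|G| -> dom K G -> elt G #|G| <= 2 * #|G| - 1 ->
    2 * k <= n ->
  #|[set B in avoid k G | ~~ dom B K]| <= #|[set B in avoid (n - k) G | ~~ dom B K]|.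
Proof.
move=> cG cK KG dKG gr kn; have G0 := count_generator_card cG; have [Gn G1 rk Gk _] := cG.
set m := 2 * #|G| - 1 in gr *; have mn : m <= n by lia.
have Gm : G \subset itv n 1 m.
  by apply: subset_trans (sub_elt_last Gn G0) _; apply: itvS.
have Km : K \subset itv n 1 m.
  apply: upto_sub; apply/eqP; rewrite eqn_leq upto_card KG -(upto_full _ _ Gm).
  exact: (domP _ _ dKG).
pose phi (T : {set 'I_n.+1}) := [&& upto T 1 == 0, dom T G & ~~ dom T K].
have E l : [set B in avoid l G | ~~ dom B K]
         = [set B in subsets_card (itv n 1 n) l | phi (B :&: itv n 1 m)].
  apply/setP=> B; rewrite inE [in RHS]inE [B \in subsets_card _ _]inE /phi.
  rewrite upto_prefix !dom_prefix //; have -> : minn 1 m = 1 by lia.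
  apply/andP/andP => [[/mem_avoid[-> -> -> ->] ->]|]; first by rewrite !eqxx.
  move=> [/andP[Bn /eqP Bc] /and3P[/eqP B1 dB dK]].
  by split=> //; apply/mem_avoid.
rewrite !E !card_by_prefix // big_mkcond [leqRHS]big_mkcond /=; apply: leq_sum => T _.
(* Traces with more than k elements contribute 0 on the left, so only t <= k remains. *)
case: ifP => // /and3P[Tm phiT Tk]; rewrite Tm phiT /=.
have rT : #|G| <= #|T|.
  by case/and3P: phiT => _ /domP/(_ m); rewrite (upto_full _ _ Gm) (upto_full _ _ Tm).
move: {phiT Tm} Tk rT; move: #|T| => t tk rt.
rewrite ifT; last by lia.
by apply: bin_leq_inner; rewrite /m; lia.
Qed.

Theorem theorem1p2 (n k : nat) (hk : 4 <= 2 * k) (hn : 2 * k <= n)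
    (G : {set 'I_n.+1}) (hG : generator k G) :
  (* (i) *)
  (MLCIF k (F_gen k G) /\
   (#|F_gen k G|%:Z
    = (\sum_(A in lower0 G) 'C(n - set_max A, k - #|G|))%N%:Z
      + 'C(n - 1, k - 1)%N%:Z
      - #|lower (smallest (k - 1) (reflect_set (n + 1) (gen_bar k G)))|%N%:Z)%R) /\
  (* (ii); the two strict inequalities fail for n = 2k *)
  (weak_generator k G ->
     [/\ elt G #|G| < 2 * #|G| - 2 -> 2 * k < n ->
           #|F_gen k G| > #|F_gen k (del_last G)|,
         elt G #|G| = 2 * #|G| - 2 ->
           #|F_gen k G| = #|F_gen k (del_last G)|
       & elt G #|G| > 2 * #|G| - 2 -> 2 * k < n ->
           #|F_gen k G| < #|F_gen k (del_last G)|]) /\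
  (* (iii) *)
  (strong_generator k G ->
     forall K : {set 'I_n.+1}, generator k K -> cle K G ->
       #|F_gen k K| >= #|F_gen k G|).
Proof.
have cG := generator_count hG; have G0 := count_generator_card cG.
have [Gn _ rk Gk _] := cG.
have k0 : 0 < k by lia.
have kn : k <= n by lia.
have FG := card_F_gen cG k0 kn.
split; [|split].
- split.
    split; [|exact: F_gen_left_compressed|exact: F_gen_maximal].
    by apply/subsetP=> A /(mem_F_gen cG)[].
  rewrite (card_lower_reflect cG) // -card_avoid_sum ?G0 //; lia.
- move=> [_ tG]; have cL := del_last_generator cG tG.
  have FL := card_F_gen cL k0 kn.
  have [Q Q0 EQ] := card_avoid_del_last cG cL.
  have Ek : #|G|.-1 <= k by lia.
  have Enk : #|G|.-1 <= n - k by lia.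
  (* Together with [FG] this says that the size for the shortened generator minus the size for G is
     Q (C(n - g, a) - C(n - g, b)), where a + b = n - (2r - 2); the three cases compare n - g with a
     + b. *)
  rewrite (EQ _ Ek) (EQ _ Enk) in FL.
  have gk : elt G #|G| <= k + #|G| - 1 by rewrite leq_elt ?G0 //= (upto_full _ _ Gk).
  set g := elt G #|G| in FL gk *.
  set a := k - #|G|.-1 in FL; set b := n - k - #|G|.-1 in FL.
  split=> [gr lt|gr|gr lt].
  + have : 'C(n - g, a) < 'C(n - g, b) by apply: bin_lt_inner; rewrite /a /b; lia.
    by rewrite -(ltn_pmul2l Q0); lia.
  + have e : n - g = a + b by rewrite /a /b; lia.
    have : 'C(n - g, a) = 'C(n - g, b) by rewrite e -(bin_sub (leq_addr b a)) addKn.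
    by move=> eC; rewrite eC in FL; lia.
  + have : 'C(n - g, b) < 'C(n - g, a).
      (* Now n - g < a + b, so b is replaced by n - g - b, which is less than a; g <= k + r - 1
         gives b <= n - g. *)
      rewrite -(bin_sub (_ : b <= n - g)); last by rewrite /b; lia.
      by apply: bin_lt_inner; rewrite /a /b; lia.
    by rewrite -(ltn_pmul2l Q0); lia.
- move=> [_ tG] K hK KG; have cK := generator_count hK.
  have FK := card_F_gen cK k0 kn.
  have [Kn _ _ _ _] := cK.
  move: KG; rewrite cle_dom // => /andP[/eqP KG dKG].
  (* Strength enters here: the type is r, so g_r itself satisfies the defining bound. *)
  have gr : elt G #|G| <= 2 * #|G| - 1 by have := gtype_half G; rewrite tG; apply.
  have := leq_card_avoid_diff cG cK KG dKG gr hn.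
  by have := card_avoid_dom k _ _ dKG; have := card_avoid_dom (n - k) _ _ dKG; lia.
Qed.
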